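(* Let each $f_i:\mathcal H\to\mathbb R$ be convex and continuously differentiable, with gradient $\nabla f_i$ Lipschitz with constant $L_i$, and let $F(x)=\mathbb E_{i\sim\mathcal D}[f_i(x)]$, where $F$ is $\mu$-strongly convex, $\mu>0$. Set $\sigma^2=\mathbb E_{i\sim\mathcal D}\|\nabla f_i(x_\star)\|_2^2$, where $x_\star=\arg\min_xF(x)$, set $\overline L=\mathbb E_{i\sim\mathcal D}L_i$, and let $\varepsilon_0=\|x_0-x_\star\|_2^2$ for a starting point $x_0\in\mathcal H$. Let $$w(i)=\frac12+\frac12\cdot\frac{L_i}{\overline L}.$$ For any desired $\varepsilon>0$, consider the $w$-weighted SGD iterates $x_{k+1}=x_k-\frac{\gamma}{w(i_k)}\nabla f_{i_k}(x_k)$, with $i_0,i_1,\dots$ drawn i.i.d. from the weighted distribution $\mathcal D^{(w)}$, with step size $$\gamma=\frac{\mu\varepsilon}{4(\varepsilon\mu\overline L+\sigma^2)}.$$ Then $\mathbb E^{(w)}\|x_k-x_\star\|_2^2\le\varepsilon$ for every integer $k\ge0$ with $$k\ge 4\log(2\varepsilon_0/\varepsilon)\Bigl(\frac{\overline L}{\mu}+\frac{\sigma^2}{\mu^2\varepsilon}\Bigr)$$ (if $\varepsilon_0=0$, the condition on $k$ is regarded as satisfied by every $k\ge 0$).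
   Context: $\mathcal H$ is $\mathbb R^d$ with the Euclidean norm $\|\cdot\|_2$, or a Hilbert space with norm $\|\cdot\|_2$. $\mathcal D$ is a probability distribution (the source distribution) on an arbitrary probability space of indices $i$. Lipschitz gradient with constant $L_i$ means $\|\nabla f_i(x)-\nabla f_i(y)\|_2\le L_i\|x-y\|_2$ for all $x,y$. $F$ is $\mu$-strongly convex means $\langle x-y,\nabla F(x)-\nabla F(y)\rangle\ge\mu\|x-y\|_2^2$ for all $x,y$. The gradient estimates are unbiased: $\mathbb E_{i\sim\mathcal D}\nabla f_i(x)=\nabla F(x)$ for all $x$; $\overline L<\infty$ and $\sigma^2<\infty$. For a nonnegative weight function $w$ with $\mathbb E_{i\sim\mathcal D}[w(i)]=1$, the weighted distribution $\mathcal D^{(w)}$ is given by $\mathbb P_{\mathcal D^{(w)}}(I)=\mathbb E_{i\sim\mathcal D}[\mathbf 1_I(i)w(i)]$ for events $I$, and $\mathbb E^{(w)}$ denotes expectation when indices are sampled i.i.d. from $\mathcal D^{(w)}$. $\log$ is the natural logarithm. *)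

(* Defs.v *)
From HB Require Import structures.
From mathcomp Require Import all_boot all_order all_algebra.
From mathcomp Require Import all_classical all_reals all_analysis.
Set Implicit Arguments.
Unset Strict Implicit.
Unset Printing Implicit Defensive.
Import Order.TTheory GRing.Theory Num.Theory.
Import numFieldNormedType.Exports.
Local Open Scope classical_set_scope.
Local Open Scope ring_scope.

(* A real Hilbert space is rendered as [H : completeNormedModType R] with a    *)
(* positive definite symmetric bilinear form [ip : {dot H for @idfun R}] that  *)
(* induces the norm.                                                           *)
Definition induces_norm (R : realType) (H : completeNormedModType R)
    (ip : {dot H for @idfun R}) : Prop :=
  forall x : H, ip x x = `|x| ^+ 2.

(* [g] is the gradient of [f]: the Riesz representative of its differential.  *)
Definition has_gradient (R : realType) (H : completeNormedModType R)
    (ip : {dot H for @idfun R}) (f : H -> R) (g : H -> H) : Prop :=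
  forall x : H, differentiable (f : H -> R^o) x /\
    forall v : H, 'd (f : H -> R^o) x v = ip (g x) v.

Definition strongly_convex (R : realType) (H : completeNormedModType R)
    (ip : {dot H for @idfun R}) (mu : R) (gradF : H -> H) : Prop :=
  forall x y : H, mu * `|x - y| ^+ 2 <= ip (x - y) (gradF x - gradF y).

Definition is_argmin (R : realType) (T : Type) (F : T -> R) (x : T) : Prop :=
  forall y : T, F x <= F y.

(* H-valued expectations are Bochner integrals: limits of the integrals of     *)
(* measurable simple functions converging to X pointwise and in mean.          *)
Definition measurable_simple (d : measure_display) (T : measurableType d)
    (H : Type) (s : {fimfun T >-> H}) : Prop :=
  forall v : H, measurable (s @^-1` [set v]).

Definition simple_expectation (R : realType) (d : measure_display)
    (T : measurableType d) (P : probability T R) (H : lmodType R)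
    (s : {fimfun T >-> H}) : H :=
  \sum_(v \in range s) fine (P (s @^-1` [set v])) *: v.

Definition bochner_expectation (R : realType) (d : measure_display)
    (T : measurableType d) (P : probability T R) (H : completeNormedModType R)
    (X : T -> H) (m : H) : Prop :=
  exists s : nat -> {fimfun T >-> H},
    [/\ forall n, measurable_simple (s n),
        forall t, s n t @[n --> \oo] --> X t,
        'E_P[(fun t => `|X t - s n t|)%R]%E @[n --> \oo] --> 0%:E
      & simple_expectation P (s n) @[n --> \oo] --> m].

(* The set function A |-> E_(i ~ D)[1_A(i) w(i)].                              *)
Definition weighted (R : realType) (d : measure_display)
    (I : measurableType d) (D : probability I R) (w : I -> R)
    (A : set I) : \bar R :=
  'E_D[(fun i => \1_A i * w i)%R]%E.

Definition mutually_independent (R : realType) (d d' : measure_display)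
    (Omega : measurableType d) (P : probability Omega R)
    (I : measurableType d') (X : nat -> {RV P >-> I}) : Prop :=
  forall (s : seq nat) (A : nat -> set I), uniq s ->
    (forall k, measurable (A k)) ->
    P (\bigcap_(k in [set` s]) (X k @^-1` A k)) =
    (\prod_(k <- s) P (X k @^-1` A k))%E.

Definition iid (R : realType) (d d' : measure_display)
    (Omega : measurableType d) (P : probability Omega R)
    (I : measurableType d') (X : nat -> {RV P >-> I})
    (nu : set I -> \bar R) : Prop :=
  mutually_independent X /\
  forall k (A : set I), measurable A -> distribution P (X k) A = nu A.

Definition partial_weight (R : realType) (I : Type) (L : I -> R) (Lbar : R)
    (i : I) : R := 1 / 2 + 1 / 2 * (L i / Lbar).

Fixpoint sgd (R : realType) (H : lmodType R) (I : Type) (gradf : I -> H -> H)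
    (w : I -> R) (gamma : R) (x0 : H) (idx : nat -> I) (k : nat) : H :=
  if k is n.+1 then
    let x := sgd gradf w gamma x0 idx n in
    x - (gamma / w (idx n)) *: gradf (idx n) x
  else x0.

(* Main.v *)
Require Import Defs.
From HB Require Import structures.
From mathcomp Require Import all_boot all_order all_algebra.
From mathcomp Require Import all_classical all_reals all_analysis.
From mathcomp Require Import finmap measurable_realfun ring lra.
Import Order.TTheory GRing.Theory Num.Theory.
Import numFieldNormedType.Exports.
Set Implicit Arguments.
Unset Strict Implicit.
Unset Printing Implicit Defensive.
Local Open Scope classical_set_scope.
Local Open Scope ring_scope.

(** The heart of the matter is a one-step bound at a fixed point [v]
    ([step_drift]): if [i] follows the weighted law, the expectation of
    [|v - (gamma / w i) g_i(v) - xstar|^2] is at most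
    [q |v - xstar|^2 + 4 gamma^2 sigma2], where
    [q = 1 - 2 gamma mu (1 - 2 gamma Lbar)].  Expand the square.  Integrating
    against the weighted law multiplies by [w] and integrates against [D], so
    the weights cancel in the cross term, which becomes
    [- 2 gamma <v - xstar, gradF v>] by unbiasedness, and the last term becomes
    [gamma^2 E_D (|g_i(v)|^2 / w i)].  Split [g_i(v)] into
    [g_i(v) - g_i(xstar)] and [g_i(xstar)].  Co-coercivity of the gradient of a
    convex function with Lipschitz gradient ([cocoercive]) bounds the square of
    the first part by [L i <v - xstar, g_i(v) - g_i(xstar)>], and the weight
    [1/2 + L i / (2 Lbar)] is made so that both [1 / w i <= 2] and
    [L i / w i <= 2 Lbar] hold ([weighted_step_bound]).  Strong convexity and
    [gradF xstar = 0] conclude.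

    The bound passes from fixed points to the iterates ([drift_step]) because
    [x_k] depends on the indices before [k] only, and these are independent of
    index [k] ([past_indep], [ge0_integral_indep]).  The space may be
    non-separable and the gradients are measurable in the index at each fixed
    point only, but each [x_k] stays in the closure of a countable set
    ([separably_measurable]).  So cut the probability space into countably many
    past events on which [x_k] is [e]-close to a fixed [v_n], apply independence
    and the one-step bound there, and add up; replacing [x_k] by [v_n] costs
    [O(e)] since all steps are Lipschitz with the same constant, again by
    [L i / w i <= 2 Lbar].  Then let [e] tend to 0.

    Iterating, the mean square error after [k] steps is at most
    [q^k eps0 + eps / 2], the step size being such that the accumulated noise
    stays below [eps / 2] ([noise_le]).  As [q <= 1 - gamma mu <= exp(- gamma mu)],
    the stated number of steps brings the first term below [eps / 2]
    ([bias_le]).  This uses [0 <= q], which follows from [mu <= Lbar]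
    ([strong_convexity_le_Lbar]) as soon as the space has a point other than
    [xstar]; if it has none, the error is zero. *)

(** * Convex functions with Lipschitz gradient *)

Lemma le_of_linear_slack (R : realFieldType) (a b m : R) : 0 <= m ->
  (forall t, 0 < t -> t <= 1 -> a <= b + t * m) -> a <= b.
Proof.
move=> m0 abm; apply/ler_addgt0Pr => e e0.
have m1 : 0 < m + 1 by rewrite ltr_wpDl.
pose t := Num.min 1 (e / (m + 1)).
have t0 : 0 < t by rewrite lt_min ltr01 divr_gt0.
apply: le_trans (abm t t0 _) _; first by rewrite ge_min lexx.
rewrite lerD2l; apply: (@le_trans _ _ (t * (m + 1))).
  by rewrite ler_pM2l// lerDl.
by rewrite -ler_pdivlMr// ge_min lexx orbT.
Qed.

Section Hilbert.
Context (R : realType) (H : completeNormedModType R).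
Context (ip : {dot H for @idfun R}).
Hypothesis hip : induces_norm ip.
Implicit Types (a b c : H) (t s : R).

Lemma ipC a b : ip a b = ip b a.
Proof. by rewrite hermC/= expr0 mul1r. Qed.

Lemma ipBl a b c : ip (a - b) c = ip a c - ip b c.
Proof. exact: linearBl. Qed.

Lemma ipBr a b c : ip c (a - b) = ip c a - ip c b.
Proof. exact: linearBr. Qed.

Lemma ipZl t a b : ip (t *: a) b = t * ip a b.
Proof. by rewrite linearZl_LR. Qed.

Lemma ipZr t a b : ip a (t *: b) = t * ip a b.
Proof. by rewrite ipC ipZl ipC. Qed.

Lemma normB_sqr a b : `|a - b| ^+ 2 = `|a| ^+ 2 - 2 * ip a b + `|b| ^+ 2.
Proof. rewrite -!hip ipBl !ipBr (ipC b a); ring. Qed.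

Lemma ip_le_norm a b : ip a b <= `|a| * `|b|.
Proof.
have [->|a0] := eqVneq a 0; first by rewrite linear0l normr0 mul0r.
have [->|b0] := eqVneq b 0; first by rewrite linear0r normr0 mulr0.
have := sqr_ge0 `| `|b| *: a - `|a| *: b|.
have na : 0 < `|a| by rewrite normr_gt0.
have nb : 0 < `|b| by rewrite normr_gt0.
rewrite normB_sqr !normrZ !normr_id ipZl ipZr => h.
have : 0 <= (2 * (`|a| * `|b|)) * (`|a| * `|b| - ip a b) by nra.
by rewrite pmulr_rge0 ?subr_ge0// !mulr_gt0.
Qed.

Lemma norm_ip_le a b : `|ip a b| <= `|a| * `|b|.
Proof.
rewrite ler_norml ip_le_norm andbT lerNl.
by rewrite -(normrN a) -linearNl ip_le_norm.
Qed.

Lemma lipschitz_le (L : R) (g : H -> H) :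
  L.-lipschitz g -> forall x y, `|g x - g y| <= L * `|x - y|.
Proof. by move=> gL x y; exact: (gL (x, y)). Qed.

Lemma is_derive_line (f : H -> R) (g : H -> H) (x h : H) (t : R) :
  has_gradient ip f g ->
  is_derive t (1 : R) ((fun s => f (x + s *: h)) : R -> R) (ip (g (x + t *: h)) h).
Proof.
move=> fg; have [df dfE] := fg (x + t *: h).
have dl : is_diff t (fun s : R => x + s *: h) ( *:%R^~ h).
  have -> : ( *:%R^~ h) = 0 + ( *:%R^~ h) by rewrite add0r.
  exact: (is_diffD (is_diff_cst x t) (is_diff_scalel t h)).
have dc : is_diff t ((f : H -> R^o) \o (fun s : R => x + s *: h))
   ((ip (g (x + t *: h)) : H -> R^o) \o ( *:%R^~ h)).
  apply: is_diff_comp; apply: DiffDef => //; apply/funext => v; exact: dfE.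
apply: DeriveDef; first exact/diff_derivable/ex_diff.
by rewrite deriveE; [rewrite diff_val/= scale1r|exact: ex_diff].
Qed.

Lemma continuous_line (f : H -> R) (g : H -> H) (x h : H) (a b : R) :
  has_gradient ip f g ->
  {within `[a, b], continuous ((fun s => f (x + s *: h)) : R -> R)}.
Proof.
move=> fg; apply: continuous_subspaceT => t.
apply/differentiable_continuous/derivable1_diffP.
by have [] := is_derive_line x h t fg.
Qed.

Lemma gradient_argmin (f : H -> R) (g : H -> H) (x : H) :
  has_gradient ip f g -> is_argmin f x -> g x = 0.
Proof.
move=> fg fx; have dl t := is_derive_line x (g x) t fg.
have h0 : (0 : R) \in `]-1, 1[%R by rewrite in_itv/=; apply/andP; split; lra.
have [] := @derive1_at_min _ (fun s => f (x + s *: g x)) (-1) 1 0 _ _ h0.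
- lra.
- by move=> t _; have [] := dl t.
- by move=> t _; rewrite scale0r addr0; exact: fx.
move=> _; have [_] := dl 0; rewrite scale0r addr0 => -> /eqP.
by rewrite hip sqrf_eq0 normr_eq0 => /eqP.
Qed.

(** The mean value theorem compares the difference quotients of [f] at [x],
    which convexity bounds by [f (x + h) - f x], with the gradient at a nearby
    point; the Lipschitz condition makes the error vanish with [t]. *)
Lemma gradient_first_order (L : R) (f : H -> R) (g : H -> H) :
  convex_function setT f -> has_gradient ip f g -> 0 <= L -> L.-lipschitz g ->
  forall x h, f x + ip (g x) h <= f (x + h).
Proof.
move=> fc fg L0 /lipschitz_le gL x h.
have key (t : R) : 0 < t -> t <= 1 ->
    ip (g x) h <= f (x + h) - f x + t * (L * `|h| ^+ 2).
  move=> t0 t1.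
  have fth : f (x + t *: h) <= (1 - t) * f x + t * f (x + h).
    have := fc (Itv01 (ltW t0) t1) (x + h) x (mem_set I) (mem_set I).
    rewrite convRE {1}/conv/= scalerDr addrAC -scalerDl unstable.add_onemK scale1r.
    by rewrite [X in _ <= X -> _]addrC.
  have [c] := MVT t0 (fun s _ => is_derive_line x h s fg) (@continuous_line f g x h 0 t fg).
  rewrite in_itv/= => /andP[c0 ct]; rewrite subr0 scale0r addr0 => fE.
  have gE : ip (g x) h - ip (g (x + c *: h)) h <= t * (L * `|h| ^+ 2).
    rewrite -ipBl; apply: le_trans (ip_le_norm _ _) _.
    have := gL x (x + c *: h); rewrite opprD addNKr normrN normrZ gtr0_norm// => gc.
    apply: le_trans (ler_wpM2r (normr_ge0 h) gc) _.
    have : 0 <= L * `|h| ^+ 2 by rewrite mulr_ge0 ?sqr_ge0.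
    nra.
  suff : ip (g (x + c *: h)) h <= f (x + h) - f x by lra.
  rewrite -(ler_pM2r t0); lra.
rewrite -lerBrDl; apply: (@le_of_linear_slack _ _ _ (L * `|h| ^+ 2)); last exact: key.
by rewrite mulr_ge0// sqr_ge0.
Qed.

(** Along the segment, [f] minus its claimed quadratic majorant has a
    nonpositive derivative. *)
Lemma descent_lemma (L : R) (f : H -> R) (g : H -> H) :
  has_gradient ip f g -> L.-lipschitz g ->
  forall x h, f (x + h) <= f x + ip (g x) h + L / 2 * `|h| ^+ 2.
Proof.
move=> fg /lipschitz_le gL x h.
pose phi (t : R) := f (x + t *: h) - (t * ip (g x) h + t ^+ 2 * (L / 2 * `|h| ^+ 2)).
have dphi t : is_derive t (1 : R) phi
    (ip (g (x + t *: h)) h - (ip (g x) h + t * (L * `|h| ^+ 2))).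
  have df := is_derive_line x h t fg.
  have -> : phi = ((fun s => f (x + s *: h)) : R -> R) -
      (ip (g x) h *: (id : R -> R) + (L / 2 * `|h| ^+ 2) *: ((id : R -> R) ^+ 2)).
    by apply/funext => s; rewrite /phi !fctE /= /GRing.scale /=; ring.
  have dq := is_deriveD (is_deriveZ (ip (g x) h) (is_derive_id t (1 : R)))
    (is_deriveZ (L / 2 * `|h| ^+ 2) (is_deriveX 2 (is_derive_id t (1 : R)))).
  have dB := is_deriveB df dq.
  apply: (is_derive_eq dB).
  rewrite /GRing.scale/= expr1; by field.
have dphi1 (t : R) : t \in `]0, 1[%R -> derivable phi t 1 by have [] := dphi t.
have dphi_le0 (t : R) : t \in `]0, 1[%R -> phi^`()%classic t <= 0.
  rewrite in_itv/= => /andP[t0 _].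
  have [_] := dphi t; rewrite derive1E => ->.
  have gt0 := gL (x + t *: h) x.
  rewrite [x + _]addrC addrK normrZ gtr0_norm// in gt0.
  have := ip_le_norm (g (x + t *: h) - g x) h; rewrite ipBl.
  have := ler_wpM2r (normr_ge0 h) gt0.
  rewrite [t *: h + x]addrC; lra.
have cphi : {within `[0, 1], continuous phi}.
  apply: continuous_subspaceT => t.
  apply/differentiable_continuous/derivable1_diffP.
  by have [] := dphi t.
have : phi 1 <= phi 0.
  by apply: (ler0_derive1_le_cc dphi1 dphi_le0 cphi); rewrite ?in_itv/= ?lexx ?ler01.
rewrite /phi scale1r scale0r addr0; lra.
Qed.

(** The Baillon-Haddad inequality.  The gap at [v] between [f] and its tangent at
    [u] is at least [|g v - g u|^2 / (2 L)]: compare that tangent with the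
    quadratic majorant of [f] at [v], at the point where their difference is
    smallest.  Adding the same inequality with [u] and [v] exchanged eliminates
    [f]. *)
Lemma cocoercive (L : R) (f : H -> R) (g : H -> H) :
  convex_function setT f -> has_gradient ip f g -> 0 <= L -> L.-lipschitz g ->
  forall x y, `|g x - g y| ^+ 2 <= L * ip (x - y) (g x - g y).
Proof.
move=> fc fg L0 gL x y.
have [LE|Lneq0] := eqVneq L 0.
  have := lipschitz_le gL x y; rewrite LE !mul0r normr_le0 => /eqP ->.
  by rewrite normr0 expr0n.
have half u v : `|g v - g u| ^+ 2 / (2 * L) <= f v - f u - ip (g u) (v - u).
  (* [v + h] minimises the quadratic majorant at [v] minus the tangent at [u]. *)
  pose h := - L^-1 *: (g v - g u).
  have lo := gradient_first_order fc fg L0 gL u (v - u + h).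
  have up := descent_lemma fg gL v h.
  have E : u + (v - u + h) = v + h by rewrite addrA [u + _]addrC subrK.
  rewrite E linearDr/= in lo.
  have E2 : ip (g v) h - ip (g u) h = - L^-1 * `|g v - g u| ^+ 2.
    by rewrite -ipBl ipZr hip.
  have E3 : L / 2 * `|h| ^+ 2 = `|g v - g u| ^+ 2 / (2 * L).
    by rewrite normrZ normrN exprMn real_normK ?num_real//; field.
  have E4 : - L^-1 * `|g v - g u| ^+ 2 = - 2 * (`|g v - g u| ^+ 2 / (2 * L)).
    by field.
  lra.
have := half x y; have := half y x.
rewrite -(opprB x y) -(opprB (g x)) normrN linearNr/= => h1 h2.
have : `|g x - g y| ^+ 2 / L <= ip (x - y) (g x - g y).
  rewrite ipBr !(ipC (x - y)).
  have -> : `|g x - g y| ^+ 2 / L = 2 * (`|g x - g y| ^+ 2 / (2 * L)) by field.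
  lra.
by rewrite ler_pdivrMr ?lt0r ?Lneq0// mulrC.
Qed.

End Hilbert.

(** * Change of measure and independence from the past *)

Lemma ge0_integral_affine d (T : measurableType d) (R : realType) (P : probability T R)
    (f : T -> R) (a b : R) : 0 <= a -> 0 <= b -> (forall t, 0 <= f t) ->
  measurable_fun setT f ->
  (\int[P]_t (a * f t + b)%:E = a%:E * \int[P]_t (f t)%:E + b%:E)%E.
Proof.
move=> a0 b0 f0 mf; under eq_integral do rewrite EFinD EFinM.
rewrite ge0_integralD//.
- rewrite ge0_integralZl//; first by rewrite integral_cst//= probability_setT mule1.
    exact/measurable_EFinP.
  by move=> t _; rewrite lee_fin.
- by move=> t _; rewrite -EFinM lee_fin mulr_ge0.
- by apply: emeasurable_funM => //; exact/measurable_EFinP.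
Qed.

Section Density.
Local Open Scope ereal_scope.
Import HBNNSimple.

(** It suffices to compare the two integrals on nonnegative simple functions,
    where they agree term by term, and to pass to monotone limits. *)
Lemma ge0_integral_density d (T : measurableType d) (R : realType)
    (mu nu : {measure set T -> \bar R}) (w : T -> R) (phi : T -> \bar R) :
  measurable_fun setT w -> (forall x, (0 <= w x)%R) ->
  (forall A, measurable A -> nu A = \int[mu]_x (\1_A x * w x)%:E) ->
  measurable_fun setT phi -> (forall x, 0 <= phi x) ->
  \int[nu]_x phi x = \int[mu]_x (phi x * (w x)%:E).
Proof.
move=> mw w0 nuE mphi phi0.
pose s := nnsfun_approx measurableT mphi.
have cvgs x : (s n x)%:E @[n --> \oo] --> phi x.
  by apply: cvg_nnsfun_approx.
have nds x : {homo (fun n => (s n x)%:E) : n m / (n <= m)%N >-> n <= m}.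
  by move=> a b ab; rewrite lee_fin; exact/lefP/nd_nnsfun_approx.
have sE n : \int[nu]_x (s n x)%:E = \int[mu]_x ((s n x)%:E * (w x)%:E).
  have mind (r : R) : measurable_fun setT (fun x => (r * \1_(s n @^-1` [set r]) x)%:E).
    exact/measurable_EFinP/measurable_funM.
  transitivity (\sum_(r \in range (s n))
      \int[nu]_x (r * \1_(s n @^-1` [set r]) x)%:E).
    under eq_integral do rewrite fimfunE -fsumEFin//.
    by rewrite ge0_integral_fsum// => r x _; exact: nnfun_muleindic_ge0.
  under [RHS]eq_integral => x _.
    rewrite fimfunE -fsumEFin// ge0_mule_fsuml; last first.
      by move=> r; exact: nnfun_muleindic_ge0.
    over.
  rewrite [RHS]ge0_integral_fsum//; last 2 first.
  - by move=> r; apply: emeasurable_funM => //; exact/measurable_EFinP.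
  - move=> r x _; apply: mule_ge0; last by rewrite lee_fin.
    by rewrite EFinM nnfun_muleindic_ge0.
  apply: eq_fsbigr => r /set_mem[x _ rE]; rewrite integralZl_indic_nnsfun//.
  rewrite integral_indic// setIT nuE//.
  under [RHS]eq_integral do rewrite -EFinM -mulrA EFinM.
  rewrite ge0_integralZl//.
  - exact/measurable_EFinP/measurable_funM.
  - by move=> y _; rewrite lee_fin mulr_ge0.
  - by rewrite lee_fin -rE.
transitivity (limn (fun n => \int[nu]_x (s n x)%:E)).
  rewrite -monotone_convergence//.
  - by apply: eq_integral => x _; exact/esym/cvg_lim.
  - by move=> n; exact/measurable_EFinP.
  - by move=> n x _; rewrite lee_fin.
rewrite [X in limn X](_ : _ = fun n => \int[mu]_x ((s n x)%:E * (w x)%:E)); last first.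
  exact/funext.
rewrite -monotone_convergence//.
- apply: eq_integral => x _; apply/cvg_lim => //.
  exact: cvgeZr.
- by move=> n; apply: emeasurable_funM; exact/measurable_EFinP.
- by move=> n x _; rewrite mule_ge0 ?lee_fin.
- by move=> x _ a b ab; rewrite lee_wpmul2r ?lee_fin ?nds// -lee_fin; exact: nds.
Qed.

Lemma integral_indic_mul d (T : measurableType d) (R : realType)
    (mu : {measure set T -> \bar R}) (A : set T) (phi : T -> \bar R) :
  \int[mu]_(x in A) phi x = \int[mu]_x (phi x * (\1_A x)%:E).
Proof. by rewrite integral_mkcond; apply: eq_integral => x _; rewrite epatch_indic. Qed.

(** The law of [X] under the restriction of [P] to [A] is the multiple [P A] of
    its law under [P]. *)
Lemma ge0_integral_indep d d' (T : measurableType d) (I : measurableType d')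
    (R : realType) (P : probability T R) (X : {RV P >-> I}) (A : set T)
    (phi : I -> \bar R) :
  measurable A ->
  (forall B, measurable B -> P (A `&` X @^-1` B) = P A * P (X @^-1` B)) ->
  measurable_fun setT phi -> (forall i, 0 <= phi i) ->
  \int[P]_(x in A) phi (X x) = P A * \int[P]_x phi (X x).
Proof.
move=> mA indep mphi phi0.
have mphiX : measurable_fun setT (phi \o X) by apply: measurableT_comp.
have PA : P A = (fine (P A))%:E by rewrite fineK// fin_num_measure.
pose c := NngNum (fine_ge0 (measure_ge0 P A)).
transitivity (\int[mrestr P mA]_x phi (X x)).
  rewrite integral_indic_mul; apply/esym.
  apply: (@ge0_integral_density _ _ _ P (mrestr P mA) \1_A (phi \o X)) => //;
    last by move=> x; exact: phi0.
  move=> B mB; under eq_integral do rewrite EFinM.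
  by rewrite -integral_indic_mul integral_indic.
transitivity (\int[pushforward (mrestr P mA) X]_i phi i).
  by rewrite ge0_integral_pushforward.
transitivity (\int[mscale c (distribution P X)]_i phi i).
  apply: eq_measure_integral => B mB _.
  by rewrite /= /pushforward /mrestr /mscale/= setIC indep// PA.
by rewrite ge0_integral_mscale//= -PA ge0_integral_distribution.
Qed.

End Density.

Section History.
Local Open Scope ereal_scope.
Context (R : realType) d d' (Omega : measurableType d) (P : probability Omega R)
  (I : measurableType d') (idx : nat -> {RV P >-> I}).

(** Rectangles in the first [k] indices; they generate the sigma-algebra of
    events decided before index [k], and are stable under intersection. *)
Definition past (k : nat) : set (set Omega) :=
  [set A | exists2 B : nat -> set I, (forall j, measurable (B j)) &
    A = \bigcap_(j < k) (idx j @^-1` B j)].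

Definition pastT (k : nat) := g_sigma_algebraType (past k).

Lemma past_measurable k (A : set (pastT k)) : measurable A -> d.-measurable A.
Proof.
apply: smallest_sub; first exact: sigma_algebra_measurable.
move=> _ [B mB ->]; apply: bigcap_measurableType => j _.
by rewrite -[X in measurable X]setTI; exact: measurable_funP.
Qed.

Lemma past_S k (A : set (pastT k)) : measurable A -> measurable (A : set (pastT k.+1)).
Proof.
apply: smallest_sub; first exact: smallest_sigma_algebra.
move=> _ [B mB ->]; apply: sub_sigma_algebra.
exists (fun j => if (j < k)%N then B j else setT).
  by move=> j; case: ifP.
apply/seteqP; split => x /= h j.
  by move=> _; case: ifP => // jk; exact: h.
by move=> jk; have := h j (ltnW jk); rewrite jk.
Qed.

Lemma past_idx k : measurable_fun setT (idx k : pastT k.+1 -> I).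
Proof.
move=> _ B mB; rewrite setTI; apply: sub_sigma_algebra.
exists (fun j => if j == k then B else setT); first by move=> j; case: ifP.
apply/seteqP; split => x /= h.
  by move=> j _; case: eqP => [->|].
by have := h k (ltnSn k); rewrite eqxx.
Qed.

(** Mutual independence gives the product rule on rectangles.  As functions of
    [A], both sides are finite measures, and two finite measures that agree on a
    generating family closed under intersection agree everywhere. *)
Lemma past_indep k (A : set (pastT k)) (B : set I) :
  mutually_independent idx -> measurable A -> measurable B ->
  P (A `&` idx k @^-1` B) = P A * P (idx k @^-1` B).
Proof.
move=> indep mA mB.
have mX j (C : set I) : measurable C -> measurable (idx j @^-1` C).
  by move=> mC; rewrite -[X in measurable X]setTI; exact: measurable_funP.
have mXB := mX k _ mB.
have PB : P (idx k @^-1` B) = (fine (P (idx k @^-1` B)))%:E.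
  by rewrite fineK// fin_num_measure.
pose c := NngNum (fine_ge0 (measure_ge0 P (idx k @^-1` B))).
pose G := [set X | past k X /\ X `<=` setT].
have GE : G = past k.
  by apply/seteqP; split => X; [case|split].
have rect (s : seq nat) C : uniq s -> (forall j, measurable (C j)) ->
   P (\bigcap_(j in [set` s]) (idx j @^-1` C j)) = \prod_(j <- s) P (idx j @^-1` C j).
  exact: indep.
suff : mrestr P mXB A = mscale c P A.
  by rewrite /mrestr /mscale/= -PB muleC.
apply: (g_sigma_algebra_measure_unique_trace (past k) setT) => //.
- move=> X [[C mC ->] _]; apply: bigcap_measurableType => j _; exact: mX.
- rewrite -/G GE => _ _ [C1 mC1 ->] [C2 mC2 ->].
  exists (fun j => C1 j `&` C2 j); first by move=> j; exact: measurableI.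
  by rewrite -bigcapI.
- by rewrite /= /mrestr /mscale/= setTI probability_setT mule1 -PB.
- move=> X [[C mC ->] _].
  rewrite /= /mrestr /mscale/= -PB.
  (* The intersection of a rectangle with an event on index [k] is a rectangle
     in the first [k.+1] indices. *)
  pose C' j := if j == k then B else C j.
  have mC' j : measurable (C' j) by rewrite /C'; case: ifP.
  have iotaE n (D : nat -> set I) : \bigcap_(j < n) (idx j @^-1` D j) =
      \bigcap_(j in [set` iota 0 n]) (idx j @^-1` D j).
    by congr (\bigcap_(j in _) _); apply/seteqP; split => j /=; rewrite mem_iota.
  have -> : \bigcap_(j < k) (idx j @^-1` C j) `&` idx k @^-1` B =
      \bigcap_(j < k.+1) (idx j @^-1` C' j).
    apply/seteqP; split => x /=.
      move=> [h xB] j; rewrite /= ltnS leq_eqVlt /C'; case: eqP => [->//|_] /= jk.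
      exact: h.
    move=> h; split.
      by move=> j /= jk; have := h j (ltnW jk); rewrite /C' ltn_eqF.
    by have := h k (ltnSn k); rewrite /C' eqxx.
  rewrite !iotaE !rect ?iota_uniq// -addn1 iotaD big_cat/= add0n big_seq1.
  rewrite {2}/C' eqxx muleC; congr (_ * _).
  rewrite !big_seq; apply: eq_bigr => j; rewrite mem_iota add0n => /andP[_ jk].
  by rewrite /C' ltn_eqF.
- by rewrite /= /mrestr/= setTI PB ltry.
- by rewrite -/G GE; exact: mA.
Qed.

End History.

(** * Separable measurability of vector-valued maps *)

Lemma measurable_fun_lt d (T : measurableType d) (R : realType) (f : T -> R) :
  (forall r, measurable [set x | f x < r]) -> measurable_fun setT f.
Proof.
move=> mf; apply: (measurability _ (RGenInftyO.measurableE R)) => _ [_ [r ->] <-].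
by rewrite setTI preimage_itvNyo; exact: mf.
Qed.

Lemma measurable_lt_const d (T : measurableType d) (R : realType) (f : T -> R) r :
  measurable_fun setT f -> measurable [set x | f x < r].
Proof.
move=> mf; rewrite [X in measurable X](_ : _ = setT `&` f @^-1` `]-oo, r[).
  exact: mf.
by rewrite setTI preimage_itvNyo.
Qed.

Lemma measurable_fun_inv d (T : measurableType d) (R : realType) (f : T -> R) :
  measurable_fun setT f -> (forall x, 0 < f x) -> measurable_fun setT (fun x => (f x)^-1).
Proof.
move=> mf f0; apply: measurable_fun_lt => r.
have [r0|r0] := leP r 0.
  rewrite [X in measurable X](_ : _ = set0)//; apply/seteqP; split => // x /=.
  by move=> /lt_le_trans/(_ r0); rewrite invr_lt0 ltNge ltW.
rewrite [X in measurable X](_ : _ = [set x | - f x < - r^-1]).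
  exact/measurable_lt_const/measurableT_comp.
apply/seteqP; split => x /=; rewrite ltrN2.
  by move=> h; rewrite -[ltRHS]invrK ltf_pV2 ?posrE ?invr_gt0.
by move=> h; rewrite -[ltRHS]invrK ltf_pV2 ?posrE ?invr_gt0.
Qed.

Section SeparablyMeasurable.
Context (R : realType) (H : normedModType R).

(** Borel measurability with separable range, in the form that needs no
    sigma-algebra on [H] and lets the sigma-algebra on the source vary. *)
Definition separably_measurable d (T : measurableType d) (X : T -> H) :=
  (exists v : nat -> H, forall t e, 0 < e -> exists n, `|X t - v n| < e) /\
  (forall u, measurable_fun setT (fun t => `|X t - u|)).

Lemma dense_sequence (K : countType) (T : Type) (X : T -> H) (v : K -> H) :
  (forall t e, 0 < e -> exists k, `|X t - v k| < e) ->
  exists v' : nat -> H, forall t e, 0 < e -> exists n, `|X t - v' n| < e.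
Proof.
move=> vX; exists (fun n => if @choice.unpickle K n is Some k then v k else 0) => t e e0.
by have [k] := vX t e e0; exists (choice.pickle k); rewrite choice.pickleK.
Qed.

Lemma separably_measurable_cst d (T : measurableType d) (x : H) :
  separably_measurable (fun _ : T => x).
Proof.
split; first by exists (fun=> x) => t e e0; exists 0; rewrite subrr normr0.
by move=> u; exact: measurable_cst.
Qed.

(** The distance from [tau (Z t) (X t)] to [u] is the infimum over [n] of
    [|tau (Z t) (v n) - u| + C |X t - v n|], by the Lipschitz condition and since
    the [v n] approximate [X t]; each of these functions of [t] is measurable as
    [v n] is a fixed point of [H]. *)
Lemma separably_measurable_comp d d' (T : measurableType d) (I : measurableType d')
    (tau : I -> H -> H) (C : R) (Z : T -> I) (X : T -> H) :
  0 <= C -> (forall i x y, `|tau i x - tau i y| <= C * `|x - y|) ->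
  (forall x, separably_measurable (tau ^~ x)) ->
  measurable_fun setT Z -> separably_measurable X ->
  separably_measurable (fun t => tau (Z t) (X t)).
Proof.
move=> C0 tauC mtau mZ [[v vX] mX].
have C1 : 0 < C + 1 by rewrite ltr_wpDl.
have vtau t e : 0 < e -> exists n, C * `|X t - v n| < e.
  move=> e0; have [n nX] := vX t (e / (C + 1)) (divr_gt0 e0 C1).
  exists n; apply: (@le_lt_trans _ _ ((C + 1) * `|X t - v n|)).
    by rewrite ler_wpM2r// lerDl.
  by rewrite mulrC -ltr_pdivlMr.
split.
  have /choice [u uE] n := (mtau (v n)).1.
  apply: (@dense_sequence (nat * nat)%type _ _ (fun k => u k.1 k.2)) => t e e0.
  have e20 : 0 < e / 2 by rewrite divr_gt0.
  have [n nX] := vtau t _ e20.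
  have [m mX'] := uE n (Z t) _ e20.
  exists (n, m) => /=; rewrite -(subrKA (tau (Z t) (v n))).
  apply: le_lt_trans (ler_normD _ _) _; rewrite [e]splitr ltrD//.
  exact: le_lt_trans (tauC _ _ _) nX.
move=> u; apply: measurable_fun_lt => r.
rewrite [X in measurable X](_ : _ = \bigcup_n
    [set t | `|tau (Z t) (v n) - u| + C * `|X t - v n| < r]).
  apply: bigcupT_measurable => n; apply: measurable_lt_const.
  apply: measurable_funD; last by apply: measurable_funM => //; exact: mX.
  exact: (measurableT_comp ((mtau (v n)).2 u) mZ).
apply/seteqP; split => t /=.
  move=> tr; have e0 : 0 < (r - `|tau (Z t) (X t) - u|) / 2.
    by rewrite divr_gt0// subr_gt0.
  have [n nX] := vtau t _ e0; exists n => //=.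
  have := ler_normD (tau (Z t) (v n) - tau (Z t) (X t)) (tau (Z t) (X t) - u).
  rewrite subrKA (distrC _ (tau (Z t) (X t))).
  have := tauC (Z t) (X t) (v n); lra.
move=> [n _] /=; apply: le_lt_trans.
rewrite -(subrKA (tau (Z t) (v n))); apply: le_trans (ler_normD _ _) _.
by rewrite addrC lerD2l.
Qed.

End SeparablyMeasurable.

Section Bochner.
Context (R : realType) (H : completeNormedModType R) d (T : measurableType d)
  (P : probability T R).

Lemma measurable_fun_simple (s : {fimfun T >-> H}) (phi : H -> T -> R) :
  measurable_simple s -> (forall v, measurable_fun setT (phi v)) ->
  measurable_fun setT (fun t => phi (s t) t).
Proof.
move=> ms mphi _ B mB; rewrite setTI.
rewrite [X in measurable X](_ : _ =
    \bigcup_(v in range s) (s @^-1` [set v] `&` phi v @^-1` B)).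
  apply: fin_bigcup_measurable => [|v _]; first exact: fimfunP.
  apply: measurableI; first exact: ms.
  by rewrite -[X in measurable X]setTI; exact: mphi.
apply/seteqP; split => t /=; first by move=> tB; exists (s t) => //; exists t.
by move=> [_ [t' _ <-] [/= <-]].
Qed.

(** What remains of a Bochner expectation when convergence in mean is dropped. *)
Definition strongly_measurable (X : T -> H) :=
  exists2 s : nat -> {fimfun T >-> H},
    (forall n, measurable_simple (s n)) & forall t, s n t @[n --> \oo] --> X t.

Lemma bochner_strongly_measurable X m :
  bochner_expectation P X m -> strongly_measurable X.
Proof. by case=> s [? ? _ _]; exists s. Qed.

Lemma measurable_fun_strongly (X : T -> H) (phi : H -> T -> R) :
  strongly_measurable X -> (forall v, measurable_fun setT (phi v)) ->
  (forall t, continuous (phi ^~ t)) -> measurable_fun setT (fun t => phi (X t) t).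
Proof.
move=> [s ms sX] mphi cphi.
apply: (measurable_fun_cvg (h := fun n t => phi (s n t) t)).
  by move=> n; exact: measurable_fun_simple.
move=> t _; exact: (cvg_comp _ _ (sX t) (cphi t (X t))).
Qed.

Lemma strongly_measurable_dense (X : T -> H) : strongly_measurable X ->
  exists v : nat -> H, forall t e, 0 < e -> exists n, `|X t - v n| < e.
Proof.
move=> [s _ sX].
pose F n : seq H := finmap.enum_fset (fset_set (range (s n))).
apply: (@dense_sequence R H (nat * nat)%type T X (fun k => nth 0 (F k.1) k.2)) => t e e0.
have /cvgrPdist_lt/(_ _ e0) [n _ /(_ n (leqnn n)) /= nX] := sX t.
exists (n, index (s n t) (F n)); rewrite /= nth_index//.
have : s n t \in fset_set (range (s n)).
  by rewrite in_fset_set//; apply/mem_set; exists t.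
by [].
Qed.

(** The range is approximated by [a - p *: v] with [p] rational and [v] a value
    of one of the simple functions approximating [X]. *)
Lemma separably_measurable_affine (X : T -> H) (c : T -> R) (a : H) :
  strongly_measurable X -> measurable_fun setT c ->
  separably_measurable (fun t => a - c t *: X t).
Proof.
move=> mX mc; split.
  have [v vX] := strongly_measurable_dense mX.
  apply: (@dense_sequence R H (nat * rat)%type T (fun t => a - c t *: X t)
    (fun k => a - ratr k.2 *: v k.1)).
  move=> t e e0; have e20 : 0 < e / 2 by rewrite divr_gt0.
  have c1 : 0 < `|c t| + 1 by rewrite ltr_wpDl.
  have [n nX] := vX t (e / 2 / (`|c t| + 1)) (divr_gt0 e20 c1).
  have v1 : 0 < `|v n| + 1 by rewrite ltr_wpDl.
  have dl : 0 < e / 2 / (`|v n| + 1) by rewrite divr_gt0.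
  have [q] : exists q : rat, `|c t - ratr q| < e / 2 / (`|v n| + 1).
    have : c t - e / 2 / (`|v n| + 1) < c t + e / 2 / (`|v n| + 1) by lra.
    move=> /rat_in_itvoo [q]; rewrite in_itv/= => /andP[q1 q2].
    by exists q; rewrite ltr_norml; apply/andP; split; lra.
  rewrite ltr_pdivlMr// => cq; exists (n, q) => /=.
  rewrite ltr_pdivlMr// in nX.
  rewrite opprD opprK addrACA subrr add0r addrC distrC.
  rewrite -(subrKA (c t *: v n)) -scalerBr -scalerBl.
  apply: le_lt_trans (ler_normD _ _) _; rewrite !normrZ [e]splitr.
  have := normr_ge0 (X t - v n); have := normr_ge0 (c t - ratr q).
  nra.
move=> u; apply: (measurable_fun_strongly (phi := fun v t => `|a - c t *: v - u|)) => //.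
  move=> v; apply: (@measurable_comp _ _ _ _ _ _ setT (fun r : R => `|a - r *: v - u|)) => //.
  apply: continuous_measurable_fun => r.
  apply: cvg_norm; apply: cvgB; last exact: cvg_cst.
  by apply: cvgB; [exact: cvg_cst|exact: scalel_continuous].
move=> t v; apply: cvg_norm; apply: cvgB; last exact: cvg_cst.
by apply: cvgB; [exact: cvg_cst|exact: scaler_continuous].
Qed.

End Bochner.

(** * Inner products under Bochner expectations *)

Section BochnerIp.
Context (R : realType) (H : completeNormedModType R) (ip : {dot H for @idfun R}).
Hypothesis hip : induces_norm ip.
Context d (T : measurableType d) (P : probability T R).
Implicit Types (a m : H) (X : T -> H).

Lemma ip_continuous a : continuous (ip a).
Proof.
move=> x; apply/cvgrPdist_lt => e e0; near=> y.
rewrite -linearBr/=; apply: le_lt_trans (norm_ip_le hip _ _) _.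
have a1 : 0 < `|a| + 1 by rewrite ltr_wpDl.
apply: (@le_lt_trans _ _ ((`|a| + 1) * `|x - y|)); first by rewrite ler_wpM2r// lerDl.
rewrite mulrC -ltr_pdivlMr//.
near: y; apply: (@cvgr_dist_lt _ _ _ _ _ id); [exact: cvg_id|by rewrite divr_gt0].
Unshelve. all: by end_near. Qed.

Lemma measurable_ip a X : strongly_measurable X -> measurable_fun setT (fun t => ip a (X t)).
Proof.
move=> mX; apply: (measurable_fun_strongly (phi := fun v _ => ip a v)) => //.
by move=> t; exact: ip_continuous.
Qed.

Lemma measurable_norm_strong u X :
  strongly_measurable X -> measurable_fun setT (fun t => `|X t - u|).
Proof.
move=> mX; apply: (measurable_fun_strongly (phi := fun v _ => `|v - u|)) => //.
by move=> t v; apply: cvg_norm; apply: cvgB; [exact: cvg_id|exact: cvg_cst].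
Qed.

Lemma simple_expectation_ip a (s : {fimfun T >-> H}) : measurable_simple s ->
  P.-integrable setT (EFin \o (fun t => ip a (s t))) /\
  (\int[P]_t (ip a (s t))%:E = (ip a (simple_expectation P s))%:E)%E.
Proof.
move=> ms; pose F := fset_set (range s).
have sE t : (ip a (s t))%:E = (\sum_(v <- F) (ip a v)%:E * (\1_(s @^-1` [set v]) t)%:E)%E.
  under eq_bigr do rewrite -EFinM.
  rewrite sumEFin; congr EFin.
  have sF : s t \in F by rewrite /F in_fset_set//; apply/mem_set; exists t.
  rewrite (big_rem (s t))//= big_seq big1 ?addr0.
    by rewrite indicE mem_set//= mulr1.
  move=> v; rewrite mem_rem_uniq ?finmap.fset_uniq// inE => /andP[vs _].
  rewrite indicE memNset ?mulr0// => /= E.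
  by rewrite E eqxx in vs.
have ih v : P.-integrable setT (fun t => (ip a v)%:E * (\1_(s @^-1` [set v]) t)%:E)%E.
  by apply: integrableZl => //; exact: integrable_indic.
have iE v : (\int[P]_t (\1_(s @^-1` [set v]) t)%:E = (fine (P (s @^-1` [set v])))%:E)%E.
  by rewrite integral_indic// ?setIT ?fineK ?fin_num_measure//; exact: ms.
split.
  apply: (eq_integrable _
    (fun t => \sum_(v <- F) (ip a v)%:E * (\1_(s @^-1` [set v]) t)%:E)%E) => //.
    by move=> t _; rewrite /= sE.
  exact: integrable_sum.
under eq_integral do rewrite sE.
rewrite integral_sum//.
under eq_bigr => v _.
  rewrite integralZl//; last exact: integrable_indic.
  rewrite iE -EFinM; over.
rewrite sumEFin /simple_expectation fsbig_finite//= linear_sumr/=; congr EFin.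
by apply: eq_bigr => v _; rewrite linearZr_LR/= mulrC.
Qed.

(** Pairing with [a] is continuous and linear, so the identity holds for the
    approximating simple functions and survives the limit: by Cauchy-Schwarz the
    error is at most [|a|] times the mean distance to [X]. *)
Lemma bochner_ip a X m : bochner_expectation P X m ->
  P.-integrable setT (EFin \o (fun t => ip a (X t))) /\
  (\int[P]_t (ip a (X t))%:E = (ip a m)%:E)%E.
Proof.
move=> bX; have mX := bochner_strongly_measurable bX.
have mipX := measurable_ip a mX.
case: bX => s [ms sX Es sm].
have mXs n : measurable_fun setT (fun t => `|X t - s n t|).
  apply: (measurable_fun_simple (phi := fun v t => `|X t - v|) (ms n)) => v.
  exact: measurable_norm_strong.
have eE n : 'E_P[(fun t => `|X t - s n t|)%R]%E = (\int[P]_t (`|X t - s n t|)%:E)%E.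
  by rewrite unlock.
have bound n t : `|ip a (X t) - ip a (s n t)| <= `|a| * `|X t - s n t|.
  by rewrite -linearBr; exact: norm_ip_le.
have /fine_cvgP[fin_near fineE] := Es.
have intXs : \forall n \near \oo, P.-integrable setT (EFin \o (fun t => `|X t - s n t|)).
  apply: filterS fin_near => n; rewrite eE fin_numE => /andP[_ fin].
  apply/integrableP; split; first exact/measurable_EFinP.
  by under eq_integral do rewrite /= normr_id; rewrite ltey.
have iX : P.-integrable setT (EFin \o (fun t => ip a (X t))).
  have [n _ /(_ n (leqnn n)) /= iXs] := intXs.
  have [is_ _] := simple_expectation_ip a (ms n).
  have isum := integrableD measurableT (integrableZl measurableT `|a| iXs)
    (integrable_norm is_).
  apply: (le_integrable measurableT _ _ isum).
    exact/measurable_EFinP.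
  move=> t _ /=; rewrite lee_fin [leRHS]ger0_norm ?addr_ge0 ?mulr_ge0//.
  rewrite -[ip a (X t)](subrK (ip a (s n t))).
  by apply: le_trans (ler_normD _ _) _; rewrite lerD2r.
split => //.
pose r := (\int[P]_t ip a (X t))%R.
have rE : (\int[P]_t (ip a (X t))%:E = r%:E)%E.
  rewrite /r /Rintegral fineK//.
  exact: integrable_fin_num.
rewrite rE; congr EFin.
have cvg1 : ip a (simple_expectation P (s n)) @[n --> \oo] --> ip a m.
  apply: (@cvg_comp _ _ _ (fun n => simple_expectation P (s n)) (ip a) _ _ _ sm).
  exact: ip_continuous.
have cvg2 : ip a (simple_expectation P (s n)) @[n --> \oo] --> r.
  apply/cvgrPdist_le => e e0.
  have /cvgrPdist_le/(_ (e / (`|a| + 1))) := fineE.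
  rewrite divr_gt0// => /(_ isT); apply: filterS2 intXs => n iXs /= ne.
  have [iS ES] := simple_expectation_ip a (ms n).
  have <- : (\int[P]_t ip a (s n t))%R = ip a (simple_expectation P (s n)).
    by rewrite /Rintegral ES.
  have iB : P.-integrable setT (EFin \o (fun t => ip a (X t) - ip a (s n t))).
    exact: (integrableB measurableT iX iS).
  rewrite -RintegralB//; apply: le_trans (le_normr_Rintegral _ _) _ => //.
  rewrite sub0r normrN ger0_norm ?fine_ge0 ?expectation_ge0// eE in ne.
  apply: (@le_trans _ _ (`|a| * \int[P]_t `|X t - s n t|)%R).
    rewrite -RintegralZl//; apply: le_Rintegral => //.
    - exact: integrable_norm.
    - exact: (integrableZl measurableT `|a| iXs).
  apply: (@le_trans _ _ ((`|a| + 1) * (\int[P]_t `|X t - s n t|)%R)).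
    rewrite ler_wpM2r ?lerDl//; apply: Rintegral_ge0 => //.
  by rewrite mulrC -ler_pdivlMr// ltr_wpDl.
exact: (cvg_unique _ cvg2 cvg1).
Qed.

End BochnerIp.

(** * Recursions driven by independent noise *)

Section StochasticRecursion.
Context (R : realType) (H : completeNormedModType R).
Context d d' (Omega : measurableType d) (P : probability Omega R)
  (I : measurableType d') (idx : nat -> {RV P >-> I}).
Hypothesis indep : mutually_independent idx.
Context (tau : I -> H -> H) (C : R) (xs : H) (q c : R).
Hypothesis C0 : 0 <= C.
Hypothesis q0 : 0 <= q.
Hypothesis c0 : 0 <= c.
Hypothesis tauC : forall i x y, `|tau i x - tau i y| <= C * `|x - y|.
Hypothesis mtau : forall x, separably_measurable (tau ^~ x).
Hypothesis tau_drift : forall k v,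
  (\int[P]_t (`|tau (idx k t) v - xs| ^+ 2)%:E <= (q * `|v - xs| ^+ 2 + c)%:E)%E.

Lemma past_measurable_fun k (f : Omega -> R) :
  measurable_fun setT (f : pastT idx k -> R) -> measurable_fun setT f.
Proof. by move=> mf _ B mB; apply: (@past_measurable _ _ _ _ _ _ idx k); exact: mf. Qed.

Lemma separably_measurable_past_S k (X : Omega -> H) :
  separably_measurable (X : pastT idx k -> H) ->
  separably_measurable (X : pastT idx k.+1 -> H).
Proof.
move=> [vX mX]; split => // u _ B mB; apply: past_S.
exact: mX.
Qed.

Lemma separably_measurable_step k (X : Omega -> H) :
  separably_measurable (X : pastT idx k -> H) ->
  separably_measurable ((fun t => tau (idx k t) (X t)) : pastT idx k.+1 -> H).
Proof.
move=> mX; apply: (@separably_measurable_comp _ _ _ _ (pastT idx k.+1) _ tau C (idx k) X) => //.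
  exact: past_idx.
exact: separably_measurable_past_S.
Qed.

(** Fix [e] and let [B n] be the event that [v n] is the first point of the
    dense sequence within [e] of [X].  On [B n], replace [X] by [v n], use
    independence of [B n] and [idx k] together with the drift at [v n], and go
    back from [v n] to [X].  Both replacements cost a factor [1 + e] and a term
    of order [e]; summing over [n] and letting [e] tend to 0 gives the claim. *)
Lemma drift_step k (X : Omega -> H) (a : R) :
  separably_measurable (X : pastT idx k -> H) ->
  (\int[P]_t (`|X t - xs| ^+ 2)%:E <= a%:E)%E ->
  (\int[P]_t (`|tau (idx k t) (X t) - xs| ^+ 2)%:E <= (q * a + c)%:E)%E.
Proof.
move=> sX Xa.
have [_ mtX] := separably_measurable_step sX.
have [[v vX] mX] := sX.
have mD : measurable_fun setT (fun t => `|X t - xs| ^+ 2).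
  by apply: measurable_funX; exact: (past_measurable_fun (mX xs)).
have mD' : measurable_fun setT (fun t => `|tau (idx k t) (X t) - xs| ^+ 2).
  by apply: measurable_funX; exact: (past_measurable_fun (mtX xs)).
set J' := (\int[P]_t _)%E; set J := (\int[P]_t _)%E in Xa.
have J0 : (0 <= J)%E by apply: integral_ge0 => t _; rewrite lee_fin sqr_ge0.
have J'0 : (0 <= J')%E by apply: integral_ge0 => t _; rewrite lee_fin sqr_ge0.
have a0 : 0 <= a by rewrite -lee_fin (le_trans J0).
(* [M] bounds the slope in [e] of the error, for [e] at most 1. *)
pose M := 3 * (q * a) + 4 * q + c + 2 * C ^+ 2.
have M0 : 0 <= M by rewrite /M !addr_ge0 ?mulr_ge0 ?sqr_ge0.
suff key e : 0 < e -> e <= 1 -> (J' <= (q * a + c + e * M)%:E)%E.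
  have J'fin : J' \is a fin_num.
    rewrite ge0_fin_numE//; apply: le_lt_trans (key 1 ltr01 (lexx 1)) _.
    exact: ltry.
  rewrite -(fineK J'fin) lee_fin; apply: (@le_of_linear_slack _ _ _ M M0) => e e0 e1.
  by rewrite -lee_fin fineK// key.
move=> e0 e1.
(* [K] is [C] when [X] is replaced by [v n] inside [tau], and 1 on the way back. *)
have sq (r s K : R) : 0 <= r -> 0 <= s -> 0 <= K -> s <= r + K * e ->
    s ^+ 2 <= (1 + e) * r ^+ 2 + (e + e ^+ 2) * K ^+ 2.
  move=> r0 s0 K0 srK; apply: (@le_trans _ _ ((r + K * e) ^+ 2)).
    by rewrite ler_pXn2r ?nnegrE ?addr_ge0 ?mulr_ge0// ltW.
  rewrite -subr_ge0 (_ : _ - _ = e * (r - K) ^+ 2); last by ring.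
  by rewrite mulr_ge0 ?sqr_ge0 ?ltW.
pose alpha := (1 + e) * q * (1 + e).
pose beta := (1 + e) * (q * (e + e ^+ 2) + c) + (e + e ^+ 2) * C ^+ 2.
have alpha0 : 0 <= alpha by rewrite /alpha !mulr_ge0// addr_ge0// ltW.
have e20 : 0 <= e + e ^+ 2 by rewrite addr_ge0 ?sqr_ge0 ?ltW.
have e10 : 0 <= 1 + e by rewrite addr_ge0 ?ltW.
have beta0 : 0 <= beta.
  rewrite /beta addr_ge0//; apply: mulr_ge0 => //; last exact: sqr_ge0.
  by rewrite addr_ge0// mulr_ge0.
pose Psi t := alpha * `|X t - xs| ^+ 2 + beta.
have Psi0 t : 0 <= Psi t by rewrite /Psi addr_ge0// mulr_ge0// sqr_ge0.
have mPsi : measurable_fun setT (fun t => (Psi t)%:E).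
  by apply/measurable_EFinP; apply: measurable_funD => //; exact: measurable_funM.
pose A n : set (pastT idx k) := [set t | `|X t - v n| < e].
have mA n : measurable (A n) by exact: measurable_lt_const.
pose B : nat -> set Omega := seqDU A.
have mBp n : measurable (B n : set (pastT idx k)).
  apply: measurableD; first exact: mA.
  by apply: bigsetU_measurable => i _; exact: mA.
have mB n : measurable (B n) by exact: past_measurable (mBp n).
have BT : \bigcup_n B n = setT.
  rewrite -seqDU_bigcup_eq; apply/seteqP; split => // t _.
  by have [n] := vX t e e0; exists n.
have tB : trivIset setT B by exact: trivIset_seqDU.
suff step n : (\int[P]_(t in B n) (`|tau (idx k t) (X t) - xs| ^+ 2)%:E <=
    \int[P]_(t in B n) (Psi t)%:E)%E.
  apply: (@le_trans _ _ (\int[P]_t (Psi t)%:E)%E).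
    have splitB f : measurable_fun setT (fun t => (f t)%:E) -> (forall t, 0 <= f t) ->
        (\int[P]_t (f t)%:E = \sum_(0 <= n <oo) \int[P]_(t in B n) (f t)%:E)%E.
      move=> mf f0; rewrite -BT ge0_integral_bigcup//; first by rewrite BT.
      by move=> t _; rewrite lee_fin.
    rewrite /J' !splitB//; last exact/measurable_EFinP.
    by apply: lee_nneseries => // n _ _; apply: integral_ge0 => t _; rewrite lee_fin sqr_ge0.
  rewrite ge0_integral_affine// -/J.
  apply: (@le_trans _ _ (alpha%:E * a%:E + beta%:E)%E).
    by rewrite leeD2r// lee_wpmul2l.
  rewrite -EFinM -EFinD lee_fin /alpha /beta /M.
  rewrite -subr_ge0 [leRHS](_ : _ =
    e * (1 - e) * (q * a + q * (3 + e) + C ^+ 2)); last by ring.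
  have e30 : 0 <= 3 + e by rewrite addr_ge0 ?ltW.
  apply: mulr_ge0; first by rewrite mulr_ge0 ?subr_ge0// ltW.
  by rewrite !addr_ge0 ?mulr_ge0 ?sqr_ge0.
pose phi i := (1 + e) * `|tau i (v n) - xs| ^+ 2 + (e + e ^+ 2) * C ^+ 2.
have phi0 i : 0 <= phi i by rewrite /phi addr_ge0// mulr_ge0// sqr_ge0.
have mphi : measurable_fun setT (fun i => (phi i)%:E).
  apply/measurable_EFinP; apply: measurable_funD => //; apply: measurable_funM => //.
  apply: measurable_funX; exact: (mtau (v n)).2.
have Bn t : B n t -> `|X t - v n| < e by case.
apply: (@le_trans _ _ (\int[P]_(t in B n) (phi (idx k t))%:E)%E).
  apply: ge0_le_integral => //.

  - by apply: measurable_funTS; exact/measurable_EFinP.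
  - apply: measurable_funTS; exact: (measurableT_comp mphi).
  - move=> t /Bn Xv; rewrite lee_fin; apply: sq => //.
    rewrite -(subrKA (tau (idx k t) (v n))); apply: le_trans (ler_normD _ _) _.
    rewrite addrC lerD2l; apply: le_trans (tauC _ _ _) _.
    by rewrite ler_wpM2l// ltW.
rewrite (@ge0_integral_indep _ _ _ _ _ P (idx k) (B n) (fun i => (phi i)%:E))//; last first.
  by move=> S mS; exact: past_indep.
pose g := (1 + e) * (q * `|v n - xs| ^+ 2 + c) + (e + e ^+ 2) * C ^+ 2.
have phig : (\int[P]_t (phi (idx k t))%:E <= g%:E)%E.
  have mtk : measurable_fun setT (fun t => `|tau (idx k t) (v n) - xs| ^+ 2).
    apply: measurable_funX; apply: (measurableT_comp ((mtau (v n)).2 xs)) => //.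
  rewrite /phi ge0_integral_affine//; last by rewrite mulr_ge0 ?sqr_ge0.
  rewrite [g%:E](_ : _ = (1 + e)%:E * (q * `|v n - xs| ^+ 2 + c)%:E +
    ((e + e ^+ 2) * C ^+ 2)%:E)%E //.
  by rewrite leeD2r// lee_wpmul2l// tau_drift.
apply: (@le_trans _ _ (P (B n) * g%:E)%E); first by rewrite lee_wpmul2l.
rewrite muleC -integral_cst//; apply: ge0_le_integral => //.
- move=> t _; rewrite lee_fin /g; apply: addr_ge0; apply: mulr_ge0 => //; last exact: sqr_ge0.
  by rewrite addr_ge0// mulr_ge0// sqr_ge0.
- exact: measurable_funTS.
- move=> t /Bn Xv; rewrite lee_fin.
  have vs : `|v n - xs| ^+ 2 <= (1 + e) * `|X t - xs| ^+ 2 + (e + e ^+ 2) * 1 ^+ 2.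
    apply: sq => //; rewrite mul1r -(subrKA (X t)); apply: le_trans (ler_normD _ _) _.
    by rewrite addrC lerD2l distrC ltW.
  rewrite /Psi /alpha /beta /g.
  have := ler_wpM2l (mulr_ge0 e10 q0) vs; lra.
Qed.

(** Separable measurability with respect to the growing past has to be carried
    along the induction, since [drift_step] relies on it. *)
Lemma drift_iterate (x : nat -> Omega -> H) (x0 : H) (B : nat -> R) :
  (forall t, x 0 t = x0) ->
  (forall k t, x k.+1 t = tau (idx k t) (x k t)) ->
  `|x0 - xs| ^+ 2 <= B 0 -> (forall k, q * B k + c <= B k.+1) ->
  forall k, (\int[P]_t (`|x k t - xs| ^+ 2)%:E <= (B k)%:E)%E.
Proof.
move=> x00 xS B0 BS k.
suff [] : separably_measurable (x k : pastT idx k -> H) /\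
  (\int[P]_t (`|x k t - xs| ^+ 2)%:E <= (B k)%:E)%E by [].
elim: k => [|k [mx xB]].
  have -> : x 0 = fun=> x0 by exact/funext.
  split; first exact: separably_measurable_cst.
  by rewrite integral_cst//= probability_setT mule1 lee_fin.
have -> : x k.+1 = fun t => tau (idx k t) (x k t) by exact/funext.
split; first exact: separably_measurable_step.
by apply: le_trans (drift_step mx xB) _; rewrite lee_fin.
Qed.

End StochasticRecursion.

(** * The step size and the number of steps *)

Section StepSize.
Context (R : realType) (mu eps lbar sigma2 : R).
Hypotheses (mu0 : 0 < mu) (eps0 : 0 < eps) (lbar0 : 0 < lbar) (sigma20 : 0 <= sigma2).
Let gamma := (mu * eps) / (4 * (eps * mu * lbar + sigma2)).

Lemma step_den : 0 < eps * mu * lbar + sigma2.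
Proof. by rewrite ltr_wpDr// !mulr_gt0. Qed.

Lemma step_gt0 : 0 < gamma.
Proof. by rewrite divr_gt0 ?mulr_gt0// step_den. Qed.

Lemma step_eq : 4 * gamma * (eps * mu * lbar + sigma2) = mu * eps.
Proof. by rewrite /gamma; field; rewrite gt_eqF ?step_den. Qed.

Lemma step_le : 4 * gamma * lbar <= 1.
Proof.
have me : 0 < mu * eps by rewrite mulr_gt0.
rewrite -(ler_pM2r me) mul1r -{2}step_eq.
have := mulr_ge0 (ltW step_gt0) sigma20; lra.
Qed.

(** The factor of [|v - xstar|^2] in the one-step bound. *)
Definition contraction := 1 - 2 * gamma * mu * (1 - 2 * gamma * lbar).

Lemma contraction_ge0 : mu <= lbar -> 0 <= contraction.
Proof.
move=> mul; have := step_le; have := step_gt0; rewrite /contraction => g0 gl.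
have : gamma * mu <= gamma * lbar by rewrite ler_pM2l.
have : 0 <= gamma * mu by rewrite mulr_ge0 ?ltW.
nra.
Qed.

Lemma contraction_le : contraction <= 1 - gamma * mu.
Proof.
have := step_le; have := mulr_gt0 step_gt0 mu0; rewrite /contraction; nra.
Qed.

(** The choice of the step size: [eps / 2] is an upper bound for the fixed
    point of [r |-> contraction * r + 4 gamma^2 sigma2]. *)
Lemma noise_le : contraction * (eps / 2) + 4 * gamma ^+ 2 * sigma2 <= eps / 2.
Proof.
have h : gamma * (4 * gamma * (eps * mu * lbar + sigma2)) = gamma * (mu * eps).
  by rewrite step_eq.
have : 0 <= gamma ^+ 2 * (eps * mu * lbar).
  by rewrite mulr_ge0 ?sqr_ge0// !mulr_ge0 ?ltW.
rewrite /contraction; lra.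
Qed.

(** [contraction] is at most [exp (- gamma mu)], and the lower bound on [k] is
    exactly [ln (2 e0 / eps) / (gamma mu)]. *)
Lemma bias_le (e0 : R) (k : nat) : mu <= lbar -> 0 <= e0 ->
  e0 = 0 \/ 4 * ln (2 * e0 / eps) * (lbar / mu + sigma2 / (mu ^+ 2 * eps)) <= k%:R ->
  contraction ^+ k * e0 <= eps / 2.
Proof.
move=> mul e00 [->|hk]; first by rewrite mulr0 divr_ge0 ?ltW.
have [->|e0n0] := eqVneq e0 0; first by rewrite mulr0 divr_ge0 ?ltW.
have e0gt : 0 < e0 by rewrite lt0r e0n0.
have ratio : 0 < 2 * e0 / eps by rewrite divr_gt0 ?mulr_gt0.
have gm := mulr_gt0 step_gt0 mu0.
have lnk : ln (2 * e0 / eps) <= gamma * mu * k%:R.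
  apply: le_trans (ler_wpM2l (ltW gm) hk).
  rewrite le_eqVlt; apply/orP; left; apply/eqP; rewrite /gamma.
  by field; rewrite !gt_eqF ?step_den.
have qk : contraction ^+ k <= expR (- (gamma * mu * k%:R)).
  have -> : - (gamma * mu * k%:R) = - (gamma * mu) * k%:R by rewrite mulNr.
  rewrite expRM_natr lerXn2r ?nnegrE ?expR_ge0 ?contraction_ge0//.
  by apply: le_trans contraction_le _; exact: expR_ge1Dx.
apply: (@le_trans _ _ (expR (- ln (2 * e0 / eps)) * e0)).
  rewrite ler_pM2r//; apply: le_trans qk _.
  by rewrite ler_expR lerN2.
rewrite expRN lnK ?posrE// le_eqVlt; apply/orP; left; apply/eqP.
by field; rewrite !gt_eqF.
Qed.

End StepSize.

(** * One weighted gradient step *)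

Section Mean.
Context (R : realType) d (T : measurableType d) (P : probability T R).
Implicit Types (f g : T -> R).

(** Integrability and value together, so that linear combinations of functions
    with known means are handled in one go. *)
Definition has_mean f (m : R) : Prop :=
  P.-integrable setT (EFin \o f) /\ (\int[P]_t (f t)%:E = m%:E)%E.

Lemma has_meanZ a f m : has_mean f m -> has_mean (fun t => a * f t) (a * m).
Proof.
move=> [fi fE]; split; first exact: (integrableZl measurableT a fi).
by under eq_integral do rewrite EFinM; rewrite integralZl// fE.
Qed.

Lemma has_meanD f g m n :
  has_mean f m -> has_mean g n -> has_mean (fun t => f t + g t) (m + n).
Proof.
move=> [fi fE] [gi gE]; split; first exact: (integrableD measurableT fi gi).
by under eq_integral do rewrite EFinD; rewrite integralD// fE gE.
Qed.

Lemma has_meanB f g m n :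
  has_mean f m -> has_mean g n -> has_mean (fun t => f t - g t) (m - n).
Proof.
move=> fm gn; have := has_meanD fm (has_meanZ (-1) gn).
by rewrite mulN1r; under eq_fun do rewrite mulN1r.
Qed.

Lemma has_mean_cst a : has_mean (fun=> a) a.
Proof.
split; first exact: finite_measure_integrable_cst.
by rewrite integral_cst//= probability_setT mule1.
Qed.

Lemma has_mean_le f g m n :
  has_mean f m -> has_mean g n -> (forall t, f t <= g t) -> m <= n.
Proof.
move=> [fi fE] [gi gE] fg; rewrite -lee_fin -fE -gE.
by apply: le_integral => // t _; rewrite lee_fin.
Qed.

Lemma has_mean_ge0 f m : measurable_fun setT f -> (forall t, 0 <= f t) ->
  m%:E = 'E_P[f]%E -> has_mean f m.
Proof.
rewrite unlock => mf f0 mE; split => //.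
apply/integrableP; split; first exact/measurable_EFinP.
under eq_integral do rewrite /= ger0_norm//.
by rewrite -mE ltry.
Qed.

End Mean.

(** After expanding the square, only [|gv|^2 / w] needs a bound.  Writing [gv]
    as [(gv - gs) + gs] gives [2 |gv - gs|^2 + 2 |gs|^2]; then co-coercivity and
    [l / w <= 2 lbar] handle the first square, [1 / w <= 2] the second. *)
Lemma weighted_step_bound (R : realType) (H : completeNormedModType R)
    (ip : {dot H for @idfun R}) (u gv gs : H) (l lbar w gamma : R) :
  induces_norm ip -> 0 <= l -> 2^-1 <= w -> l <= 2 * lbar * w ->
  `|gv - gs| ^+ 2 <= l * ip u (gv - gs) ->
  `|u - (gamma / w) *: gv| ^+ 2 * w <= `|u| ^+ 2 * w - 2 * gamma * ip u gv +
     4 * gamma ^+ 2 * (lbar * ip u (gv - gs) + `|gs| ^+ 2).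
Proof.
move=> hip l0 w2 lw coco.
have w0 : 0 < w by apply: lt_le_trans w2; rewrite invr_gt0.
have ip0 : 0 <= ip u (gv - gs).
  have [E|ln0] := eqVneq l 0.
    move: coco; rewrite E mul0r => h.
    have : `|gv - gs| ^+ 2 == 0 by rewrite eq_le h sqr_ge0.
    by rewrite sqrf_eq0 normr_eq0 => /eqP ->; rewrite linear0r.
  have lgt : 0 < l by rewrite lt0r ln0.
  by rewrite -(pmulr_rge0 _ lgt) (le_trans _ coco)// sqr_ge0.
have par : `|gv| ^+ 2 <= 2 * `|gv - gs| ^+ 2 + 2 * `|gs| ^+ 2.
  have := normB_sqr hip gv gs; have := sqr_ge0 `|gv - gs - gs|.
  rewrite (normB_sqr hip (gv - gs) gs) ipBl -(hip gs); lra.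
have E : `|u - (gamma / w) *: gv| ^+ 2 * w =
    `|u| ^+ 2 * w - 2 * gamma * ip u gv + gamma ^+ 2 * (`|gv| ^+ 2 / w).
  rewrite (normB_sqr hip) normrZ ipZr exprMn real_normK ?num_real//.
  by field; rewrite gt_eqF.
have gvw : `|gv| ^+ 2 / w <= 4 * (lbar * ip u (gv - gs) + `|gs| ^+ 2).
  rewrite ler_pdivrMr//.
  have h1 : l * ip u (gv - gs) <= 2 * lbar * w * ip u (gv - gs) by rewrite ler_wpM2r.
  have h2 : `|gs| ^+ 2 * 2^-1 <= `|gs| ^+ 2 * w by rewrite ler_wpM2l ?sqr_ge0.
  lra.
by rewrite E; have := ler_wpM2l (sqr_ge0 gamma) gvw; lra.
Qed.

Definition sgd_step (R : realType) (H : lmodType R) (I : Type)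
    (gradf : I -> H -> H) (w : I -> R) (gamma : R) (i : I) (x : H) : H :=
  x - (gamma / w i) *: gradf i x.

Section WeightedSgd.
Context (R : realType) (H : completeNormedModType R) (ip : {dot H for @idfun R})
  (d : measure_display) (I : measurableType d) (D : probability I R)
  (f : I -> H -> R) (gradf : I -> H -> H) (L : I -> R)
  (F : H -> R) (gradF : H -> H) (mu sigma2 Lbar : R) (xstar : H).
Hypotheses (hip : induces_norm ip)
  (f_convex : forall i, convex_function setT (f i))
  (f_gradient : forall i, has_gradient ip (f i) (gradf i))
  (L_ge0 : forall i, 0 <= L i)
  (gradf_lipschitz : forall i, (L i).-lipschitz (gradf i))
  (F_gradient : has_gradient ip F gradF)
  (gradf_unbiased : forall x, bochner_expectation D (gradf ^~ x) (gradF x))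
  (F_strongly_convex : strongly_convex ip mu gradF)
  (xstar_argmin : is_argmin F xstar)
  (sigma2_def : sigma2%:E = 'E_D[(fun i => `|gradf i xstar| ^+ 2)%R]%E)
  (L_measurable : measurable_fun setT L)
  (Lbar_def : Lbar%:E = 'E_D[L]%E).

Let w := partial_weight L Lbar.

Lemma mean_lipschitz : has_mean D L Lbar.
Proof. exact: has_mean_ge0. Qed.

Lemma mean_gradient a x : has_mean D (fun i => ip a (gradf i x)) (ip a (gradF x)).
Proof. exact: bochner_ip. Qed.

Lemma mean_residual : has_mean D (fun i => `|gradf i xstar| ^+ 2) sigma2.
Proof.
apply: has_mean_ge0 => //.
apply: measurable_funX; have mg := bochner_strongly_measurable (gradf_unbiased xstar).
have := measurable_norm_strong 0 mg.
by under eq_fun do rewrite subr0.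
Qed.

Lemma residual_ge0 : 0 <= sigma2.
Proof.
by apply: has_mean_le (has_mean_cst D 0) mean_residual _ => i; exact: sqr_ge0.
Qed.

Lemma Lbar_ge0 : 0 <= Lbar.
Proof. exact: has_mean_le (has_mean_cst D 0) mean_lipschitz _. Qed.

(** Strong convexity bounds [<x - xstar, gradF x - gradF xstar>] from below; it
    is the mean of the same expression for [gradf i], which Cauchy-Schwarz and
    the Lipschitz condition bound from above by [L i |x - xstar|^2]. *)
Lemma strong_convexity_le_Lbar x : x != xstar -> mu <= Lbar.
Proof.
move=> xx; have nx : 0 < `|x - xstar| ^+ 2 by rewrite exprn_gt0// normr_gt0 subr_eq0.
rewrite -(ler_pM2r nx); apply: le_trans (F_strongly_convex x xstar) _.
rewrite ipBr mulrC.
apply: has_mean_le (has_meanB (mean_gradient _ x) (mean_gradient _ xstar))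
  (has_meanZ _ mean_lipschitz) _ => i.
rewrite -ipBr; apply: le_trans (ip_le_norm hip _ _) _.
rewrite expr2 -mulrA ler_wpM2l// mulrC.
exact: lipschitz_le (gradf_lipschitz i) _ _.
Qed.

Lemma weight_measurable : measurable_fun setT w.
Proof.
apply: measurable_funD => //; apply: measurable_funM => //.
by apply: measurable_funM.
Qed.

Lemma weight_ge_half i : 2^-1 <= w i.
Proof.
by rewrite /w /partial_weight mul1r lerDl mulr_ge0 ?invr_ge0// divr_ge0// Lbar_ge0.
Qed.

Lemma weight_gt0 i : 0 < w i.
Proof. by apply: lt_le_trans (weight_ge_half i); rewrite invr_gt0. Qed.

Hypothesis Lbar_gt0 : 0 < Lbar.

Lemma lipschitz_le_weight i : L i <= 2 * Lbar * w i.
Proof.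
rewrite /w /partial_weight [leRHS](_ : _ = Lbar + L i); first by rewrite lerDr Lbar_ge0.
by field; rewrite gt_eqF.
Qed.

Lemma mean_weight : has_mean D w 1.
Proof.
have := has_meanD (has_mean_cst D (1 / 2)) (has_meanZ (1 / 2 / Lbar) mean_lipschitz).
rewrite (_ : 1 / 2 + _ = 1); last by field; rewrite gt_eqF.
by under eq_fun do rewrite mulrAC -mulrA.
Qed.

Variable gamma : R.
Let step := sgd_step gradf w gamma.
Hypotheses (gamma_ge0 : 0 <= gamma) (gamma_le : 4 * gamma * Lbar <= 1).

(** The constant does not depend on [i], as the weight grows with [L i]. *)
Lemma step_lipschitz i x y :
  `|step i x - step i y| <= (1 + gamma * (2 * Lbar)) * `|x - y|.
Proof.
rewrite /step /sgd_step opprD addrACA -opprD -scalerBr; apply: le_trans (ler_normB _ _) _.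
rewrite mulrDl mul1r lerD2l normrZ ger0_norm; last first.
  by rewrite divr_ge0// ltW// weight_gt0.
have w0 := weight_gt0 i.
rewrite -!mulrA ler_wpM2l// mulrC ler_pdivrMr//.
apply: le_trans (lipschitz_le (gradf_lipschitz i) x y) _.
have := ler_wpM2r (normr_ge0 (x - y)) (lipschitz_le_weight i); lra.
Qed.

Lemma step_measurable x : separably_measurable (step ^~ x).
Proof.
apply: separably_measurable_affine.
  exact: bochner_strongly_measurable (gradf_unbiased x).
apply: measurable_funM => //; apply: measurable_fun_inv weight_gt0.
exact: weight_measurable.
Qed.

(** The integrand is at most [bound], a combination of functions whose means are
    known; strong convexity is applied to the mean of [bound]. *)
Lemma step_drift x :
  (\int[D]_i ((`|step i x - xstar| ^+ 2)%:E * (w i)%:E) <=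
   ((1 - 2 * gamma * mu * (1 - 2 * gamma * Lbar)) * `|x - xstar| ^+ 2
     + 4 * gamma ^+ 2 * sigma2)%:E)%E.
Proof.
pose u := x - xstar.
pose bound i := `|u| ^+ 2 * w i - 2 * gamma * ip u (gradf i x) +
  4 * gamma ^+ 2 * (Lbar * (ip u (gradf i x) - ip u (gradf i xstar)) + `|gradf i xstar| ^+ 2).
have gs0 : gradF xstar = 0 by exact: gradient_argmin F_gradient xstar_argmin.
have [bi bE] : has_mean D bound (`|u| ^+ 2 * 1 - 2 * gamma * ip u (gradF x) +
    4 * gamma ^+ 2 * (Lbar * (ip u (gradF x) - ip u (gradF xstar)) + sigma2)).
  apply: has_meanD.
    exact: has_meanB (has_meanZ _ mean_weight) (has_meanZ _ (mean_gradient _ _)).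
  apply/has_meanZ/has_meanD; last exact: mean_residual.
  exact/has_meanZ/has_meanB/mean_gradient/mean_gradient.
apply: (@le_trans _ _ (\int[D]_i (bound i)%:E)%E).
  apply: ge0_le_integral => //.
  - by move=> i _; rewrite mule_ge0 ?lee_fin ?sqr_ge0// ltW// weight_gt0.
  - apply: emeasurable_funM; apply/measurable_EFinP; last exact: weight_measurable.
    by apply: measurable_funX; exact: (step_measurable x).2.
  - exact: measurable_int bi.
  - move=> i _; rewrite -EFinM lee_fin /step /sgd_step addrAC.
    rewrite /bound -ipBr; apply: (weighted_step_bound _ hip (L_ge0 i)).
    + exact: weight_ge_half.
    + exact: lipschitz_le_weight.
    + exact: (cocoercive hip (f_convex i)).
rewrite bE lee_fin gs0 linear0r subr0 mulr1.
have := F_strongly_convex x xstar; rewrite gs0 subr0 -/u => sc.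
have k0 : 0 <= 2 * gamma * (1 - 2 * gamma * Lbar).
  apply: mulr_ge0; [by rewrite mulr_ge0|have := gamma_le; lra].
have := ler_wpM2l k0 sc; lra.
Qed.

End WeightedSgd.

(** * The complexity bound *)

Theorem corollary3p1 (R : realType)
  (H : completeNormedModType R) (ip : {dot H for @idfun R})
  (hip : induces_norm ip)
  (d : measure_display) (I : measurableType d) (D : probability I R)
  (f : I -> H -> R) (gradf : I -> H -> H) (L : I -> R)
  (F : H -> R) (gradF : H -> H)
  (mu sigma2 Lbar : R) (xstar x0 : H)
  (f_convex : forall i, convex_function setT (f i))
  (f_gradient : forall i, has_gradient ip (f i) (gradf i))
  (gradf_continuous : forall i, continuous (gradf i))
  (L_ge0 : forall i, 0 <= L i)
  (gradf_lipschitz : forall i, (L i).-lipschitz (gradf i))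
  (f_integrable : forall x, D.-integrable setT (EFin \o f ^~ x))
  (F_def : forall x, (F x)%:E = 'E_D[f ^~ x]%E)
  (F_gradient : has_gradient ip F gradF)
  (gradf_unbiased : forall x, bochner_expectation D (gradf ^~ x) (gradF x))
  (mu_gt0 : 0 < mu)
  (F_strongly_convex : strongly_convex ip mu gradF)
  (xstar_argmin : is_argmin F xstar)
  (sigma2_def : sigma2%:E = 'E_D[(fun i => `|gradf i xstar| ^+ 2)%R]%E)
  (L_measurable : measurable_fun setT L)
  (Lbar_def : Lbar%:E = 'E_D[L]%E)
  (eps : R) (eps_gt0 : 0 < eps)
  (d' : measure_display) (Omega : measurableType d') (P : probability Omega R)
  (idx : nat -> {RV P >-> I})
  (idx_iid : iid idx (weighted D (partial_weight L Lbar)))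
  (k : nat) :
  let eps0 := `|x0 - xstar| ^+ 2 in
  let gamma := (mu * eps) / (4 * (eps * mu * Lbar + sigma2)) in
  let x_ (n : nat) (omega : Omega) :=
    sgd gradf (partial_weight L Lbar) gamma x0 (fun j => idx j omega) n in
  (eps0 = 0 \/
   4 * ln (2 * eps0 / eps) * (Lbar / mu + sigma2 / (mu ^+ 2 * eps)) <= k%:R) ->
  ('E_P[(fun omega => `|x_ k omega - xstar| ^+ 2)%R] <= eps%:E)%E.
Proof.
move=> eps0 gamma x_ hk; rewrite unlock.
have [indep law] := idx_iid.
set w := partial_weight L Lbar in law.
have [[x xx]|trivH] := pselect (exists x, x != xstar); last first.
  rewrite integral0_eq; first by rewrite lee_fin ltW.
  move=> t _; apply/eqP; rewrite eqe sqrf_eq0 normr_eq0 subr_eq0.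
  by apply/negPn/negP => xt; apply: trivH; exists (x_ k t).
have muL : mu <= Lbar.
  exact: (strong_convexity_le_Lbar hip L_ge0 gradf_lipschitz gradf_unbiased
    F_strongly_convex L_measurable Lbar_def xx).
have Lbar_gt0 : 0 < Lbar by exact: lt_le_trans muL.
have sigma2_ge0 : 0 <= sigma2 := residual_ge0 gradf_unbiased sigma2_def.
have gamma_gt0 : 0 < gamma by exact: step_gt0.
have gamma_le : 4 * gamma * Lbar <= 1 by exact: step_le.
pose q := contraction mu eps Lbar sigma2.
(* The first term decays from the initial error; the second absorbs the noise of
   all steps, by [noise_le]. *)
pose B n := q ^+ n * eps0 + eps / 2.
apply: (@le_trans _ _ (B k)%:E); last first.
  rewrite lee_fin /B [leRHS]splitr lerD2r.
  by apply: bias_le => //; rewrite sqr_ge0.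
have smeas := step_measurable L_ge0 gradf_unbiased L_measurable Lbar_def gamma.
have drift j v : (\int[P]_t (`|sgd_step gradf w gamma (idx j t) v - xstar| ^+ 2)%:E
    <= (q * `|v - xstar| ^+ 2 + 4 * gamma ^+ 2 * sigma2)%:E)%E.
  pose phi i := (`|sgd_step gradf w gamma i v - xstar| ^+ 2)%:E.
  have phi0 i : (0 <= phi i)%E by rewrite lee_fin sqr_ge0.
  have mphi : measurable_fun setT phi.
    by apply/measurable_EFinP/measurable_funX; exact: (smeas v).2.
  have := ge0_integral_distribution (idx j) mphi phi0; rewrite /phi/= => <-.
  rewrite (@ge0_integral_density _ _ _ D _ w phi)//.
  - exact: (step_drift hip f_convex f_gradient L_ge0 gradf_lipschitz F_gradient
      gradf_unbiased F_strongly_convex xstar_argmin sigma2_def L_measurable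
      Lbar_def Lbar_gt0 (ltW gamma_gt0) gamma_le).
  - exact: weight_measurable.
  - by move=> i; apply/ltW/(weight_gt0 L_ge0 L_measurable Lbar_def).
  - by move=> A mA; have := law j A mA; rewrite /weighted unlock.
apply: (drift_iterate indep (tau := sgd_step gradf w gamma)
  (C := 1 + gamma * (2 * Lbar)) (q := q)
  (c := 4 * gamma ^+ 2 * sigma2) _ _ _ _ _ _ (x := x_) (x0 := x0)) => //.
- apply: addr_ge0 => //; apply: mulr_ge0; first exact: ltW.
  by apply: mulr_ge0 => //; exact: ltW.
- exact: contraction_ge0.
- by apply: mulr_ge0 => //; apply: mulr_ge0 => //; exact: sqr_ge0.
- exact: (step_lipschitz L_ge0 gradf_lipschitz L_measurable Lbar_def Lbar_gt0 (ltW gamma_gt0)).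
- by rewrite /B expr0 mul1r lerDl divr_ge0// ltW.
- move=> n; rewrite /B mulrDr (exprS q) -(mulrA q) -addrA lerD2l.
  exact: noise_le.
Qed.
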